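(* Every nonempty (finite) factor $w$ of the Thue-Morse word $\mathbf{t}$ has circular critical exponent lying in the finite set $$\left\{ 1, 2, \tfrac{7}{3}, \tfrac{17}{7}, \tfrac{5}{2}, \tfrac{13}{5}, \tfrac{8}{3}, 3, \tfrac{10}{3}, \tfrac{7}{2}, \tfrac{11}{3}, 4 \right\}.$$
   Context: The Thue-Morse word $\mathbf{t} = t_0 t_1 t_2 \cdots = 01101001\cdots$ is the infinite fixed point, starting with $0$, of the morphism $\mu$ with $\mu(0)=01$, $\mu(1)=10$. A nonempty finite word $w$ (indexed from $0$) has period $p$, where $1 \le p \le |w|$, if $w[i]=w[i+p]$ for all $i$ with $0 \le i < |w|-p$. The smallest period of $w$ is denoted $p(w)$, and the exponent of $w$ is $\exp(w) = |w|/p(w)$. A factor of a word is a contiguous block inside it. The conjugates of a finite word $w$ are its cyclic shifts, i.e. the words $yx$ with $w = xy$ ($x,y$ possibly empty). The circular critical exponent $\mathrm{cce}(w)$ of a nonempty finite word $w$ is the supremum (maximum) of $\exp(x)$ over all nonempty factors $x$ of all conjugates of $w$. *)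

(* Defs.v *)
From mathcomp Require Import all_boot all_order all_algebra.
From mathcomp Require Import zify.

Set Implicit Arguments.
Unset Strict Implicit.
Unset Printing Implicit Defensive.

Import Order.TTheory GRing.Theory Num.Theory.

(* Binary words are [seq bool], infinite ones [nat -> bool]; the letters 0 and
   1 are [false] and [true]. *)

Definition mu (a : bool) : seq bool :=
  if a then [:: true; false] else [:: false; true].

Definition mu_word (w : seq bool) : seq bool := flatten (map mu w).

(* mu^n(0) has length 2^n > n and is a prefix of mu^(n+1)(0), so letter n of
   the fixed point can be read off mu^n(0). *)
Definition thue_morse (n : nat) : bool :=
  nth false (iter n mu_word [:: false]) n.

Definition factor_of_infinite (t : nat -> bool) (w : seq bool) : Prop :=
  exists i, w = mkseq (fun k => t (i + k)) (size w).

Definition has_period (w : seq bool) (p : nat) : bool :=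
  (0 < p <= size w) &&
  [forall i : 'I_(size w - p), nth false w i == nth false w (i + p)].

(* A nonempty w always has period |w|, so the minimum is over a nonempty set. *)
Definition min_period (w : seq bool) : nat :=
  [arg min_(p < (ord_max : 'I_(size w).+1) | has_period w p) (p : nat)].

Definition exponent (w : seq bool) : rat :=
  ((size w)%:R / (min_period w)%:R)%R.

Definition conjugates (w : seq bool) : seq (seq bool) :=
  [seq rot i w | i <- iota 0 (size w).+1].

Definition factors (w : seq bool) : seq (seq bool) :=
  [seq take k (drop i w) | i <- iota 0 (size w).+1, k <- iota 0 (size w).+1].

(* Exponents of nonempty words are at least 1, so the base value 0 does not
   affect the maximum when w is nonempty. *)
Definition cce (w : seq bool) : rat :=
  \big[Num.max/0%R]_(c <- conjugates w)
    \big[Num.max/0%R]_(x <- factors c | x != [::]) exponent x.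

Lemma size_mu_word w : size (mu_word w) = (size w).*2.
Proof. by elim: w => //= a w IH; rewrite size_cat -/(mu_word w) IH; case: a. Qed.

Lemma size_iter_mu n : size (iter n mu_word [:: false]) = 2 ^ n.
Proof. by elim: n => //= n IH; rewrite size_mu_word IH expnS mul2n. Qed.

Lemma mu_word_cat u v : mu_word (u ++ v) = mu_word u ++ mu_word v.
Proof. by rewrite /mu_word map_cat flatten_cat. Qed.

Lemma iter_mu_prefix m n : m <= n ->
  exists v, iter n mu_word [:: false] = iter m mu_word [:: false] ++ v.
Proof.
elim: n m => [|n IH] [|m] //=; first by exists [::].
  by move=> _; have [v ->] := IH 0 isT; exists (true :: mu_word v).
by move=> /IH [v ->]; exists (mu_word v); rewrite mu_word_cat.
Qed.

Lemma thue_morse_iter n k : k < 2 ^ n ->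
  nth false (iter n mu_word [:: false]) k = thue_morse k.
Proof.
move=> ltk; rewrite /thue_morse; have ltkk : k < 2 ^ k by exact: ltn_expl.
case: (leqP n k) => [|/ltnW] /iter_mu_prefix [v ->];
  by rewrite nth_cat size_iter_mu ?ltk ?ltkk.
Qed.

Lemma take_iter_mu n m : m <= 2 ^ n ->
  take m (iter n mu_word [:: false]) = mkseq thue_morse m.
Proof.
move=> lem; apply: (@eq_from_nth _ false) => [|i].
  by rewrite size_takel ?size_iter_mu // size_mkseq.
rewrite size_takel ?size_iter_mu // => lti.
by rewrite nth_take // nth_mkseq // thue_morse_iter // (leq_trans lti).
Qed.

Lemma take_mu_word m w : take m.*2 (mu_word w) = mu_word (take m w).
Proof.
elim: w m => [|a w IH] [|m]; rewrite ?double0 ?take0 //.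
have -> : take m.+1 (a :: w) = [:: a] ++ take m w by [].
by rewrite -[a :: w]cat1s !mu_word_cat -IH doubleS; case: (a).
Qed.

Lemma thue_morse0 : thue_morse 0 = false. Proof. by []. Qed.

Lemma thue_morse_fixed n :
  mu_word (mkseq thue_morse n) = mkseq thue_morse n.*2.
Proof.
have ltn2 : n < 2 ^ n by exact: ltn_expl.
rewrite -(take_iter_mu (ltnW ltn2)) -take_mu_word -(@take_iter_mu n.+1) //.
by rewrite expnS mul2n leq_double ltnW.
Qed.

Lemma min_periodP w : w != [::] ->
  has_period w (min_period w) /\
  forall p, has_period w p -> min_period w <= p.
Proof.
move=> w0; rewrite /min_period; case: arg_minnP => [|q perq minq].
  rewrite /has_period /= leqnn lt0n size_eq0 w0 /=.
  by apply/forallP => -[i Hi]; exfalso; move: Hi; rewrite subnn.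
split=> // p perp; have /andP[/andP[_ lep] _] := perp.
by apply: (minq (Ordinal (lep : p < (size w).+1))).
Qed.

Lemma mem_factors w x : (x \in factors w) = infix x w.
Proof.
apply/allpairsP/idP => [[[i k] /= [_ _ ->]]|/infixP [u [v ->]]].
  by apply/infixP; exists (take i w), (drop k (drop i w)); rewrite !cat_take_drop.
exists (size u, size x); split; last by rewrite drop_size_cat // take_size_cat.
  by rewrite mem_iota !size_cat [_.1]/=; lia.
by rewrite mem_iota !size_cat [_.2]/=; lia.
Qed.

Lemma conjugatesP w c :
  reflect (exists x y, w = x ++ y /\ c = y ++ x) (c \in conjugates w).
Proof.
apply: (iffP mapP) => [[i _ ->]|[x [y [-> ->]]]].
  by exists (take i w), (drop i w); rewrite cat_take_drop.
by exists (size x); rewrite ?rot_size_cat // mem_iota size_cat; lia.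
Qed.

Lemma exponent_ge1 w : w != [::] -> (1 <= exponent w)%R.
Proof.
move=> /min_periodP[/andP[/andP[p0 lep] _] _].
by rewrite /exponent ler_pdivlMr ?ltr0n // mul1r ler_nat.
Qed.

Lemma cce_ge w c x : c \in conjugates w -> infix x c -> x != [::] ->
  (exponent x <= cce w)%R.
Proof.
rewrite -mem_factors => cw xc x0; rewrite /cce.
apply: (le_trans (@le_bigmax_seq _ _ _ _ 0%R x (fun x => x != [::]) exponent xc x0)).
exact: (@le_bigmax_seq _ _ _ _ 0%R c xpredT
  (fun c => \big[Num.max/0%R]_(x <- factors c | x != [::]) exponent x) cw isT).
Qed.

Lemma cce_attained w : w != [::] ->
  exists c x, [/\ c \in conjugates w, infix x c, x != [::] & exponent x = cce w].
Proof.
move=> w0; pose attained r := exists c x,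
  [/\ c \in conjugates w, infix x c, x != [::] & exponent x = r].
have [cce0|//] : cce w = 0%R \/ attained (cce w).
  rewrite /cce big_seq.
  elim/big_ind: _ => [|r s|c cw]; [by left | by case: (leP r s) | ].
  rewrite big_seq_cond.
  elim/big_ind: _ => [|r s|x /andP[xc x0]]; [by left | by case: (leP r s) | ].
  by right; exists c, x; rewrite -mem_factors.
have ww : w \in conjugates w by apply/conjugatesP; exists [::], w; rewrite cats0.
have := le_trans (exponent_ge1 w0) (cce_ge ww (infix_refl w) w0).
by rewrite cce0 ler10.
Qed.

(* Main.v *)
Require Import Defs.
From mathcomp Require Import all_boot all_order all_algebra.
From mathcomp Require Import zify.

(* Repetitions of exponent greater than 2 in the circular word [w] correspond
   under [mu] to those of [mu w], with the same exponent, so a factor of even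
   length that is conjugate to the image of a shorter factor is handled by
   induction.  In the remaining factors a repetition of exponent greater than 2
   must cross the seam between the end and the beginning of [w], since the
   Thue-Morse word is overlap-free.  Every window of five letters of the
   Thue-Morse word determines the parity of its position, and the seam shifts
   that parity (odd length) or carries a misplaced square of a letter (even
   length); comparing a window with its translate by the period then bounds the
   lengths of the two sides of the seam.  For odd length there is always a
   repetition of exponent at least 7/3 near the seam, so that only periods up
   to 23 matter, and a finite computation concludes. *)

Set Implicit Arguments.
Unset Strict Implicit.
Unset Printing Implicit Defensive.

Import Order.TTheory GRing.Theory Num.Theory.

(** * Repetitions in morphic images and in the Thue-Morse word *)

Notation tm := thue_morse.

Lemma nth_mu_word w i (b : bool) : i < size w ->
  nth false (mu_word w) (i.*2 + b) = nth false w i (+) b.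
Proof.
elim: w i => [|a w IH] [|i] //= ltiw; first by case: a; case: b {IH}.
by rewrite -IH // doubleS !addSn; case: a.
Qed.

(** Stated for arbitrary letter functions, so that it applies both to [tm] and to the periodic word
    [circ w]. *)
Definition mu_image (c c' : nat -> bool) : Prop :=
  forall i (b : bool), c' (i.*2 + b) = c i (+) b.

Lemma tm_mu_image : mu_image tm tm.
Proof.
move=> i b; have := @nth_mu_word (mkseq tm i.+1) i b.
by rewrite thue_morse_fixed size_mkseq !nth_mkseq //;
  [move=> -> // | case: b; lia].
Qed.

(* Vacuous if [L <= p]. *)
Definition rep (c : nat -> bool) (i L p : nat) : Prop :=
  forall j, i <= j -> j + p < i + L -> c j = c (j + p).

Lemma mu_image_block c c' j : mu_image c c' -> ~~ odd j -> c' j.+1 = ~~ c' j.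
Proof.
move=> im ev; have := im j./2 true; have := im j./2 false.
by rewrite even_halfK // addn0 addn1 addbF addbT => -> ->.
Qed.

(* Every pair of adjacent letters is, or is shifted by [p] to, an image of a
   letter. *)
Lemma odd_rep_alternates c c' i L p j : mu_image c c' -> odd p ->
  rep c' i L p -> p.*2 < L -> i <= j -> j.+1 < i + L -> c' j.+1 = ~~ c' j.
Proof.
move=> im oddp per ltL leij ltjL.
have [oddj|/mu_image_block] := boolP (odd j); last by exact.
have [le|gt] := leqP (i + p) j.
  have Ej : j = j - p + p by lia.
  have Ej1 : j.+1 = (j - p).+1 + p by lia.
  rewrite Ej1 -per; [|lia|lia]; rewrite {2}Ej -per; [|lia|lia].
  by apply: (mu_image_block im); lia.
rewrite per; [|lia|lia]; rewrite (per j); [|lia|lia].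
by rewrite addSn; apply: (mu_image_block im); lia.
Qed.

(** Either letter of a block determines the letter it comes from, so blocks only half covered at the
    ends still count; hence [uphalf L]. *)
Lemma even_rep_descends c c' i L q : mu_image c c' -> rep c' i L q.*2 ->
  rep c i./2 (uphalf L) q.
Proof.
move=> im per j leij ltjL.
have [odd_i|ev_i] := boolP (odd i).
  have [lt|ge] := leqP i j.*2.
    have := per (j.*2 + false); rewrite addnAC -doubleD !im !addbF; apply; lia.
  have := per (j.*2 + true); rewrite addnAC -doubleD !im !addbT.
  by move=> H; apply: negb_inj; apply: H; lia.
have := per (j.*2 + false); rewrite addnAC -doubleD !im !addbF; apply; lia.
Qed.

Lemma even_rep_ascends c c' i L q : mu_image c c' -> rep c i L q ->
  rep c' i.*2 L.*2 q.*2.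
Proof.
move=> im per j leij ltjL.
have -> : j = j./2.*2 + odd j by lia.
by rewrite addnAC -doubleD !im per //; lia.
Qed.

(** Unequal neighbours in [tm] give blocks 01,10 or 10,01, whose inner letters agree and straddle a
    block boundary. Two successive equalities in [tm] would make a cube of a letter, which contains
    a block. *)
Lemma tm_not_alternating i :
  exists j, [/\ i <= j, j < i + 4, odd j & tm j.+1 = tm j].
Proof.
have step m : tm m.*2.+2 = tm m.+1 /\ tm m.*2.+1 = ~~ tm m.
  by split; [have := tm_mu_image m.+1 false | have := tm_mu_image m true];
    rewrite ?doubleS ?addn0 ?addn1 ?addbF ?addbT.
have pair m : tm m.+1 != tm m -> tm m.*2.+2 = tm m.*2.+1.
  by have [-> ->] := step m; case: (tm m.+1) (tm m) => [] [].
have [m [lem ltm neq]] : exists m, [/\ i <= m.*2.+1,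
  m.*2.+1 < i + 4 & tm m.+1 != tm m].
  pose r := i./2; have [/eqP e|] := eqVneq (tm r.+1) (tm r); last by exists r;
    split=> //; lia.
  exists r.+1; split; [lia|lia|].
  apply/eqP => e2; case: (boolP (odd r)) => o.
    by move: e2; rewrite (mu_image_block tm_mu_image); [case: (tm _) | lia].
  by move: e; rewrite (mu_image_block tm_mu_image o); case: (tm _).
by exists m.*2.+1; split=> //; [lia | rewrite pair].
Qed.

(** A five-letter window contains two equal adjacent letters; since the letters of a block differ,
    such a pair can only start at an odd position. *)
Lemma tm_sync u v : (forall j, j < 5 -> tm (u + j) = tm (v + j)) ->
  odd u = odd v.
Proof.
move=> eq_uv; have [j [lej ltj oddj eqj]] := tm_not_alternating u.
have Ej : j = u + (j - u) by lia.
have Ej1 : j.+1 = u + (j - u).+1 by lia.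
move: eqj; rewrite Ej1 {2}Ej !eq_uv; [|lia|lia].
rewrite addnS; have [o|/(mu_image_block tm_mu_image) ->] :=
  boolP (odd (v + (j - u))).
  lia.
by case: (tm _).
Qed.

(** Induction on the period: an even one is halved through [mu], an odd one forces alternation,
    which fails within five letters, or at once if [p] is 1. *)
Lemma tm_overlap_free i L p : 0 < p -> rep tm i L p -> L <= p.*2.
Proof.
elim/ltn_ind: p i L => p IH i L p0 per; rewrite leqNgt; apply/negP => ltL.
have [oddp|evp] := boolP (odd p).
  have alt j := @odd_rep_alternates _ _ i L p j tm_mu_image oddp per ltL.
  have [p1|p3] : p = 1 \/ 3 <= p by lia.
    have := alt i (leqnn _); have := per i (leqnn _).
    rewrite p1 addn1 => H1 H2; move: H2; rewrite -H1; [|lia]; case: (tm i); lia.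
  have [j [lej ltj _]] := tm_not_alternating i.
  by rewrite alt; [case: (tm j)|lia|lia].
have Ep : p = p./2.*2 by lia.
have := even_rep_descends tm_mu_image (q := p./2) (i := i) (L := L).
rewrite -Ep => /(_ per) /IH; lia.
Qed.

(** * Bounds for repetitions across a seam *)

Section Seam.
(* A repetition of length [L] glued from the factor of length [k] of the
   Thue-Morse word starting at [d] and a factor starting at [a]. *)
Variables (a d k L p : nat).
Hypothesis per : rep (fun j => if j < k then tm (d + j) else tm (a + (j - k)))
  0 L p.
Hypotheses (p0 : 0 < p) (k0 : 0 < k) (ltkL : k < L) (ltpL : p.*2 < L).

Lemma seam_left : k <= p.*2.
Proof.
apply: (@tm_overlap_free d k p) => // j ltj ltjk.
have := per (j := j - d); rewrite !ifT; [|lia|lia].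
rewrite (_ : d + (j - d) = j); last lia.
by rewrite addnA addnBA // addKn; apply; lia.
Qed.

Lemma seam_right : L - k <= p.*2.
Proof.
apply: (@tm_overlap_free a (L - k) p) => // j ltj ltjk.
have := per (j := j - a + k); rewrite !ifF; [|lia|lia].
rewrite (_ : a + (j - a + k - k) = j); [|lia].
rewrite (_ : a + (j - a + k + p - k) = j + p); [|lia].
by apply; lia.
Qed.

(** Otherwise five letters and their translate by the odd [p] both lie left of the seam, against
    [tm_sync]. *)
Lemma seam_odd_left : odd p -> k <= p + 4.
Proof.
move=> oddp; rewrite leqNgt; apply/negP => lt.
have /tm_sync : forall j, j < 5 -> tm (d + j) = tm (d + p + j); last lia.
move=> j lt5; have := per (j := j); rewrite !ifT; [|lia|lia].
by rewrite (addnC j) addnA; apply; lia.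
Qed.

Lemma seam_odd_right : odd p -> L - k <= p + 4.
Proof.
move=> oddp; rewrite leqNgt; apply/negP => lt.
have /tm_sync : forall j, j < 5 -> tm (a + j) = tm (a + p + j); last lia.
move=> j lt5; have := per (j := k + j); rewrite !ifF; [|lia|lia].
rewrite (_ : k + j + p - k = p + j); [|lia].
by rewrite addKn addnA; apply; lia.
Qed.

Lemma seam_cross : 5 <= p -> 5 <= k -> 5 <= L - k -> odd p = odd (a + d + k).
Proof.
(* The first position whose translate by [p] is not left of the seam; truncated subtraction gives 0
   when [p] exceeds [k]. *)
move=> p5 k5 L5; pose i := k - p.
have /tm_sync : forall j, j < 5 -> tm (d + i + j) = tm (a + (i + p - k) + j).
  move=> j lt5; have := per (j := i + j); rewrite ifT; [|lia].
  rewrite ifF; [|lia]; rewrite addnA => ->; [congr tm; lia|lia|lia].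
rewrite /i; lia.
Qed.

(* For [p >= 5] one has [L <= 2 p + 4] if [p] is even (one side of the seam has
   at most 4 letters) and [L <= 2 p + 8] if [p] is odd; exponent greater than
   7/3 then forces [p <= 10], respectively [p <= 23]. *)
Lemma odd_seam_bounds : odd (a + d + k) -> 7 * p < 3 * L ->
  [/\ p < 24, k <= 27, L - k <= 27 & p <= 7 -> (k <= 12) && (L - k <= 12)].
Proof.
move=> odds big; have := seam_left; have := seam_right => sr sl.
have := seam_odd_left; have := seam_odd_right; have := seam_cross.
by case: (boolP (odd p)) => op sc sor sol; split; lia.
Qed.

(** An even [p] would carry the equal letters at the seam onto a block of [tm]. So [p] is odd,
    [seam_cross] leaves at most four letters on one side unless [p] is below 5, and the other side
    has at most [p + 4]. *)
Lemma even_seam_bounds : ~~ odd (a + d + k) -> odd a -> tm a = tm (d + k).-1 ->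
  [/\ p <= 7, k <= 12 & L - k <= 12].
Proof.
move=> evs odda eqa; have := seam_left; have := seam_right => sr sl.
have := seam_odd_left; have := seam_odd_right; have := seam_cross => sc sor sol.
suff oddp : odd p by split; lia.
apply/negPn/negP => evp.
(* The pair at the seam is translated to the right if the repetition reaches that far, otherwise to
   the left. *)
have [lt|ge] := ltnP (k + p) L.
  have := per (j := k.-1); have := per (j := k).
  rewrite ltnn ifF; [|lia]; rewrite subnn addn0 => e1.
  rewrite ifT; [|lia]; rewrite ifF; [|lia].
  rewrite (_ : d + k.-1 = (d + k).-1); [|lia].
  rewrite -eqa e1; [|lia|lia].
  rewrite (_ : a + (k + p - k) = (a + (k.-1 + p - k)).+1); [|lia].
  rewrite (mu_image_block tm_mu_image); [|lia].
  by move=> H; move: (H ltac:(lia) ltac:(lia)); case: (tm _).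
have := per (j := (k - p).-1); have := per (j := k - p).
rewrite ifT; [|lia]; rewrite ifF; [|lia].
rewrite (_ : k - p + p - k = 0); [|lia]; rewrite addn0 => e1.
rewrite ifT; [|lia]; rewrite ifT; [|lia].
rewrite (_ : d + ((k - p).-1 + p) = (d + k).-1); [|lia].
rewrite -eqa -e1; [|lia|lia].
rewrite (_ : d + (k - p) = (d + (k - p).-1).+1); [|lia].
rewrite (mu_image_block tm_mu_image); [|lia].
by move=> H; move: (H ltac:(lia) ltac:(lia)); case: (tm _).
Qed.

End Seam.

(** * Longest repetitions of a finite word *)

Fixpoint max_run (cur best : nat) (s : bitseq) : nat :=
  match s with
  | [::] => maxn cur best
  | true :: s' => max_run cur.+1 best s'
  | false :: s' => max_run 0 (maxn cur best) s'
  end.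

Definition matches (x : seq bool) (p : nat) : bitseq :=
  [seq eqb ab.1 ab.2 | ab <- zip x (drop p x)].

(** A run of l agreements at distance [p] spans l + [p] letters; with no agreement the value is the
    vacuous [p]. *)
Definition max_rep (x : seq bool) (p : nat) : nat :=
  max_run 0 0 (matches x p) + p.

Definition attained (s : bitseq) (l : nat) : Prop :=
  exists2 i, i + l <= size s & forall j, i <= j -> j < i + l -> nth false s j.

(** A run at the very start of [s] prolongs the pending run of length [cur], whence the summand for
    [i == 0]. *)
Lemma max_run_ge cur best s :
  [/\ cur <= max_run cur best s, best <= max_run cur best s
    & forall i l, i + l <= size s ->
        (forall j, i <= j -> j < i + l -> nth false s j) ->
      l + (if i == 0 then cur else 0) <= max_run cur best s].
Proof.
elim: s cur best => [|b s IH] cur best /=.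
  by split=> [||i l lel _]; rewrite leq_max ?leqnn ?orbT //; case: ifP; lia.
case: b => [|].
  have [H1 H2 H3] := IH cur.+1 best; split=> [||[|i] l lel nths]; [lia|lia| |].
    case: l lel nths => [|l] lel nths; first by rewrite add0n; lia.
    rewrite /= addSnnS; apply: (H3 0 l); first lia.
    by move=> j _ ltj; apply: (nths j.+1); lia.
  have := H3 i l lel (fun j lej ltj => nths j.+1 lej ltj); case: ifP => /=; lia.
have [H1 H2 H3] := IH 0 (maxn cur best); split=> [||[|i] l lel nths];
  [lia|lia| |].
  by case: l lel nths => [|l] lel nths; [rewrite add0n /=; lia | have :=
    nths 0; rewrite /= => /(_ isT isT)].
have := H3 i l lel (fun j lej ltj => nths j.+1 lej ltj); case: ifP => /=; lia.
Qed.

Lemma max_run_attained s : attained s (max_run 0 0 s).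
Proof.
(* Generalized to an already scanned prefix [r] whose last [cur] letters are all [true]. *)
suff: forall r cur best, attained (r ++ s) best ->
    cur <= size r -> (forall j, size r - cur <= j -> j < size r ->
      nth false r j) ->
    attained (r ++ s) (max_run cur best s).
  by move=> /(_ [::] 0 0) /=; apply=> //; exists 0.
elim: s => [|b s IH] r cur best att le nths /=.
  rewrite /maxn; case: ifP => // _; exists (size r - cur); rewrite cats0;
    first lia.
  by move=> j lej ltj; apply: nths; lia.
have attcur : attained (r ++ b :: s) cur.
  exists (size r - cur); first by rewrite size_cat /=; lia.
  by move=> j lej ltj; rewrite nth_cat ifT; [apply: nths; lia | lia].
rewrite -cat_rcons in att attcur *.
case: b att attcur => att attcur; apply: IH => //; rewrite ?size_rcons //;
  last 2 first.
- by rewrite /maxn; case: ifP.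
- by move=> j; lia.
move=> j lej ltj; rewrite nth_rcons; case: ltnP => [lt|ge];
  first by apply: nths; lia.
by rewrite ifT //; lia.
Qed.

Lemma nth_matches (x : seq bool) p j : j + p < size x ->
  nth false (matches x p) j =
  (nth false x j == nth false x (j + p)).
Proof.
move=> lt; rewrite /matches (nth_map (false, false)); last first.
  by rewrite size_zip size_drop; lia.
rewrite nth_zip_cond size_zip size_drop ifT; last by lia.
by rewrite /= nth_drop addnC.
Qed.

Lemma size_matches (x : seq bool) p :
  size (matches x p) = size x - p.
Proof. by rewrite /matches size_map size_zip size_drop; lia. Qed.

Lemma max_rep_ge x p i L : i + L <= size x -> rep (nth false x) i L p ->
  L <= max_rep x p.
Proof.
move=> leL per; rewrite /max_rep.
have [_ _ /(_ i (L - p))] := max_run_ge 0 0 (matches x p).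
rewrite size_matches; have [lt|ge] := ltnP p L; last lia.
move=> H; suff: L - p + (if i == 0 then 0 else 0) <= max_run 0 0 (matches x p)
  by case: ifP; lia.
apply: H; first lia.
by move=> j lej ltj; rewrite nth_matches; [rewrite per; lia | lia].
Qed.

Lemma max_rep_attained x p : p <= size x ->
  exists2 i, i + max_rep x p <= size x & rep (nth false x) i (max_rep x p) p.
Proof.
move=> lep; have [i] := max_run_attained (matches x p).
rewrite size_matches /max_rep => lei nths; exists i; first lia.
move=> j lej ltj; have := nths j lej; rewrite nth_matches; [|lia].
by move=> H; apply/eqP/H; lia.
Qed.

(** * Circular repetitions *)

Definition circ (w : seq bool) (j : nat) : bool := nth false w (j %% size w).

(** The factors of conjugates of [w] are the windows of its periodic extension of length at most
    [size w]. *)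
Definition circ_rep (w : seq bool) (L p : nat) : Prop :=
  0 < p <= L /\ L <= size w /\ exists i, rep (circ w) i L p.

(* The pair [(a, b)] stands for the fraction a / b. *)
Definition critical_values : seq (nat * nat) :=
  [:: (7, 3); (17, 7); (5, 2); (13, 5); (8, 3); (3, 1);
      (10, 3); (7, 2); (11, 3); (4, 1)].

Definition max_critical (reps : seq (nat * nat)) : bool :=
  has (fun ab => has (fun Lp => Lp.1 * ab.2 == ab.1 * Lp.2) reps &&
                 all (fun Lp => Lp.1 * ab.2 <= ab.1 * Lp.2) reps)
      critical_values.

Definition at_most_square (reps : seq (nat * nat)) : bool :=
  all (fun Lp => Lp.1 <= Lp.2.*2) reps.

Lemma circMD (w : seq bool) j q : circ w (j + q * size w) = circ w j.
Proof. by rewrite /circ addnC modnMDl. Qed.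

Lemma circ_small (w : seq bool) j : j < size w -> circ w j = nth false w j.
Proof. by move=> lt; rewrite /circ modn_small. Qed.

Lemma circ_wrap (w : seq bool) j : size w <= j -> j < (size w).*2 ->
  circ w j = nth false w (j - size w).
Proof.
move=> le lt; rewrite -circ_small; last lia.
by rewrite -(circMD w (j - size w) 1) mul1n subnK.
Qed.

Lemma circ_rep_start (w : seq bool) L p : w != [::] -> circ_rep w L p ->
  exists2 i, i < size w & rep (circ w) i L p.
Proof.
move=> w0 [_ [_ [i per]]].
exists (i %% size w) => [|j lej ltj]; first by rewrite ltn_mod lt0n size_eq0.
rewrite -(circMD w j (i %/ size w)) -(circMD w (j + p) (i %/ size w)) addnAC.
move: lej ltj; have := divn_eq i (size w).
set m := i %/ size w * size w; set r := i %% size w => Ei lej ltj.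
by apply: per; lia.
Qed.

Lemma circ_rot k (w : seq bool) j : k <= size w ->
  circ (rot k w) j = circ w (j + k).
Proof.
move=> lek; have [|n0] := posnP (size w).
  by move/size0nil => ->; rewrite /circ !nth_nil.
rewrite /circ size_rot; have := ltn_pmod j n0; set r := j %% size w => ltr.
rewrite -modnDml -/r /rot nth_cat size_drop nth_drop.
case: ltnP => [lt|ge]; first by rewrite modn_small; [rewrite addnC | lia].
rewrite nth_take; last lia.
rewrite (_ : r + k = 1 * size w + (r + k - size w)); last lia.
by rewrite modnMDl modn_small; [congr (nth _ _ _); lia | lia].
Qed.

Lemma circ_rep_rot_sub k (w : seq bool) L p : k <= size w ->
  circ_rep (rot k w) L p -> circ_rep w L p.
Proof.
move=> lek [pL [leL [i per]]]; rewrite size_rot in leL; split=> //; split=> //.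
exists (i + k); move=> j lej ltj; have := per (j - k);
  rewrite !circ_rot // subnK; last lia.
rewrite (_ : j - k + p + k = j + p); last lia.
by apply; lia.
Qed.

Lemma circ_rep_rot k (w : seq bool) L p : k <= size w ->
  circ_rep (rot k w) L p <-> circ_rep w L p.
Proof.
move=> lek; split; first exact: circ_rep_rot_sub.
rewrite -{1}(rotK k w) /rotr size_rot; apply: circ_rep_rot_sub.
by rewrite size_rot; lia.
Qed.

(** Integer form of the conclusion, invariant under conjugation and preserved by [mu]. The first
    alternative stands for the values 1 and 2, which [circ_square] separates. *)
Definition good (w : seq bool) : Prop :=
  (forall L p, circ_rep w L p -> L <= p.*2) \/
  exists2 ab, ab \in critical_values &
    (exists L p, circ_rep w L p /\ L * ab.2 = ab.1 * p) /\
    (forall L p, circ_rep w L p -> L * ab.2 <= ab.1 * p).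

Lemma critical_values_ge ab : ab \in critical_values ->
  0 < ab.2 /\ 7 * ab.2 <= 3 * ab.1.
Proof.
move=> ab_in.
by have /allP/(_ ab ab_in)/andP[] :
  all (fun ab => (0 < ab.2) && (7 * ab.2 <= 3 * ab.1)) critical_values by [].
Qed.

Lemma good_rot k (w : seq bool) : k <= size w -> good (rot k w) -> good w.
Proof.
move=> lek [sq|[ab ab_in [[L [p [rLp E]]] mx]]].
  by left=> L p /(circ_rep_rot _ _ lek); apply: sq.
right; exists ab => //; split; first by exists L, p;
  rewrite -(circ_rep_rot _ _ lek).
by move=> L' p' /(circ_rep_rot _ _ lek); apply: mx.
Qed.

Lemma circ_mu_image (w : seq bool) : w != [::] ->
  mu_image (circ w) (circ (mu_word w)).
Proof.
move=> w0 i b; have n0 : 0 < size w by rewrite lt0n size_eq0.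
rewrite /circ size_mu_word.
have -> : (i.*2 + b) %% (size w).*2 = (i %% size w).*2 + b.
  rewrite {1}(divn_eq i (size w)) doubleD doubleMr -addnA modnMDl modn_small //.
  by have := ltn_pmod i n0; case: b; lia.
by rewrite nth_mu_word // ltn_mod.
Qed.

Lemma circ_rep_mu (w : seq bool) L p : w != [::] -> circ_rep w L p ->
  circ_rep (mu_word w) L.*2 p.*2.
Proof.
move=> /circ_mu_image im [pL [leL [i per]]]; rewrite /circ_rep size_mu_word.
by split; [lia | split; [lia | exists i.*2; apply: even_rep_ascends im per]].
Qed.

(* A repetition of odd period in the image alternates, so it has period 2. *)
Lemma circ_rep_mu_inv (w : seq bool) L p : w != [::] ->
  circ_rep (mu_word w) L p -> p.*2 < L ->
  (exists2 q, p = q.*2 & circ_rep w (uphalf L) q) \/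
  (3 <= p /\ circ_rep (mu_word w) L 2).
Proof.
move=> /circ_mu_image im [pL [leL [i per]]] ltL; rewrite size_mu_word in leL.
have [oddp|evp] := boolP (odd p); [right | left].
  have alt j := @odd_rep_alternates _ _ i L p j im oddp per ltL.
  have p1 : p <> 1.
    move=> p1; have := alt i; have := per i; rewrite p1 addn1.
    by move=> ->; [|lia|lia]; case: (circ _ _) => /(_ (leqnn _)); lia.
  split; first lia; split; first lia; split; first by rewrite size_mu_word.
  exists i => j lej ltj; rewrite addn2 alt; [|lia|lia].
  by rewrite alt ?negbK //; lia.
have Ep : p = p./2.*2 by lia.
exists p./2 => //; split; first lia; split; first lia.
by exists i./2; apply: even_rep_descends im _; rewrite -Ep.
Qed.

(** Doubling keeps exponents, and halving an even period rounds the length up, so no exponent above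
    2 is new. An odd period is replaced by the smaller period 2, which is then halved. *)
Lemma good_mu (w : seq bool) : w != [::] -> good w -> good (mu_word w).
Proof.
move=> w0 [sq|[ab ab_in [[L [p [rLp E]]] mx]]].
  left=> L p rLp; rewrite leqNgt; apply/negP => lt.
  case: (circ_rep_mu_inv w0 rLp lt) => [[q Eq /sq]|[p3 r2]]; first lia.
  case: (circ_rep_mu_inv w0 r2); [lia | | lia].
  by move=> [q Eq /sq]; lia.
have [b0 ge] := critical_values_ge ab_in.
right; exists ab => //; split.
  by exists L.*2, p.*2; split; [exact: circ_rep_mu | rewrite -doubleMl
    -doubleMr E].
have ub L' q : circ_rep w (uphalf L') q -> L' * ab.2 <= ab.1 * q.*2.
  have le : L' <= (uphalf L').*2 by lia.
  move/mx => H; apply: leq_trans (leq_mul le (leqnn ab.2)) _.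
  by rewrite -doubleMl -doubleMr leq_double.
move=> L' p' r'; have [le|lt] := leqP L' p'.*2.
  by apply: leq_trans (leq_mul le (leqnn _)) _; nia.
case: (circ_rep_mu_inv w0 r' lt) => [[q -> /ub] //|[p3 r2]].
case: (circ_rep_mu_inv w0 r2); [lia | | lia].
by move=> [q Eq /ub]; rewrite -Eq; nia.
Qed.

(** * From circular repetitions to the circular critical exponent *)

Section CceBounds.

Local Open Scope ring_scope.

(** Only an inequality, because the least period of the factor may be smaller than [p]. *)
Lemma circ_rep_cce (w : seq bool) L p : w != [::] -> circ_rep w L p ->
  L%:R / p%:R <= cce w.
Proof.
move=> w0 r; have [i ltiw per] := circ_rep_start w0 r.
have [/andP[p0 lepL] [leL _]] := r.
have Ei x : (x < size w)%N -> nth false (rot i w) x = circ w (x + i).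
  by move=> lt; rewrite -circ_rot ?circ_small ?size_rot // ltnW.
pose x := take L (rot i w).
have sx : size x = L by rewrite size_takel // size_rot.
have x0 : x != [::] by rewrite -size_eq0 sx; lia.
have perx : has_period x p.
  rewrite /has_period sx p0 lepL; apply/forallP => -[j /= ltj].
  rewrite !nth_take; [|lia|lia]; rewrite !Ei; [|lia|lia].
  by rewrite addnAC per //; lia.
have cx : rot i w \in conjugates w.
  by apply/conjugatesP; exists (take i w), (drop i w); rewrite cat_take_drop.
apply: le_trans (cce_ge cx (_ : infix x _) x0); last first.
  by rewrite -[rot i w](cat_take_drop L); apply/infixP; exists [::],
    (drop L (rot i w)).
have [/andP[/andP[m0 _] _] /(_ p perx) lem] := min_periodP x0.
by rewrite /exponent sx ler_wpM2l ?ler0n // lef_pV2 ?posrE ?ltr0n // ler_nat.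
Qed.

Lemma cce_circ_rep (w : seq bool) : w != [::] ->
  exists L p, circ_rep w L p /\ cce w = L%:R / p%:R.
Proof.
move=> w0; have [c [x [cw /infixP cx x0 <-]]] : exists c x : seq bool,
  [/\ c \in conjugates w, infix x c, x != [::] & exponent x = cce w] :=
    cce_attained w0.
have [u [v Ec]] : exists u v : seq bool, c = u ++ x ++ v by [].
exists (size x), (min_period x); split=> //.
have /mapP[k] := cw; rewrite mem_iota => ltk Ek.
have [/andP[/andP[m0 lem] /forallP per] _] := min_periodP x0.
have lek : (k <= size w)%N by lia.
rewrite -(circ_rep_rot _ _ lek) -Ek; split; first by rewrite m0.
split; first by rewrite Ec !size_cat; lia.
exists (size u) => j lej ltj.
have Ecj i : (i < size x)%N -> circ c (size u + i) = nth false x i.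
  move=> lti; rewrite circ_small; last by rewrite Ec !size_cat; lia.
  by rewrite Ec nth_cat ltnNge leq_addr /= addKn nth_cat lti.
have ltj' : (j - size u < size x - min_period x)%N by lia.
have /eqP /= := per (Ordinal ltj'); rewrite -!Ecj; [|lia|lia].
by rewrite addnA subnKC.
Qed.

(** Without equal neighbours, four letters form a square of period 2, and a circle of three letters
    cannot alternate; what remains is length 1 and the words 01 and 10. *)
Lemma circ_square (w : seq bool) : w != [::] ->
  (exists L p, circ_rep w L p /\ L = p.*2) \/
  (forall L p, circ_rep w L p -> L = p).
Proof.
move=> w0.
have pos : (0 < size w)%N by rewrite lt0n size_eq0.
have eq1 j : (1 < size w)%N -> circ w j = circ w j.+1 ->
    exists L p, circ_rep w L p /\ L = p.*2.
  move=> lt e; exists 2%N, 1%N; split=> //; split=> //; split=> //.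
  by exists j; move=> i lei lti; rewrite (_ : i = j) ?addn1 //; lia.
have [n1|] := leqP (size w) 1; first by right=> L p [? [? _]]; lia.
case: (ltnP 3 (size w)) => [n4 n1|n3 n1].
  case: (circ w 0 =P circ w 1) => [e|d0]; first by left; apply: eq1 e.
  case: (circ w 1 =P circ w 2) => [e|d1]; first by left; apply: eq1 e.
  case: (circ w 2 =P circ w 3) => [e|d2]; first by left; apply: eq1 e.
  left; exists 4, 2; split=> //; split=> //; split=> //.
  exists 0%N; case=> [|[|j]] _ ltj; last lia; rewrite ?add0n ?addn2.
    by move: d0 d1; do 3 case: (circ _ _).
  by move: d1 d2; do 3 case: (circ _ _).
have Ew : circ w (size w) = circ w 0 by rewrite -(circMD w 0 1) mul1n.
have [n2|n2] : size w = 2%N \/ size w = 3%N by lia.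
  case: (circ w 0 =P circ w 1) => [e|d0]; first by left; apply: eq1 e.
  right=> L p [/andP[p0 lep] [leL [i per]]].
  case: (ltngtP p L) => // [ltp|]; last lia.
  have [p1 L2] : p = 1%N /\ L = 2%N by lia.
  have := per i (leqnn _); rewrite p1 addn1 L2 => /(_ ltac:(lia)).
  rewrite /circ n2 !modn2 /=; move: d0; rewrite !circ_small ?n2 //.
  by case: (odd i) => /=; congruence.
left; case: (circ w 0 =P circ w 1) => [e|d0]; first by apply: eq1 e.
case: (circ w 1 =P circ w 2) => [e|d1]; first by apply: eq1 e.
case: (circ w 2 =P circ w 3) => [e|d2]; first by apply: eq1 e.
by rewrite n2 in Ew; move: d0 d1 d2; rewrite Ew; do 3 case: (circ _ _).
Qed.

Lemma good_cce (w : seq bool) : w != [::] -> good w ->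
  cce w \in [:: 1; 2; 7 / 3; 17 / 7; 5 / 2; 13 / 5; 8 / 3; 3;
                10 / 3; 7 / 2; 11 / 3; 4 : rat].
Proof.
move=> w0 gw; have [L0 [p0 [r0 E0]]] := cce_circ_rep w0.
have posp L p : circ_rep w L p -> 0 < p%:R :> rat by move=> [/andP[? _] _];
  rewrite ltr0n.
case: gw => [sq|[[a b] ab_in [[L [p [r E]]] mx]]].
  have [[L [p [r E]]]|eqLp] := circ_square w0.
    suff -> : cce w = 2 by rewrite !inE eqxx orbT.
    apply/le_anti/andP; split.
      rewrite E0 ler_pdivrMr ?(posp _ _ r0) // -natrM ler_nat mul2n.
      exact: sq.
    have := circ_rep_cce w0 r; rewrite E -mul2n natrM mulfK //.
    by rewrite gt_eqF // (posp _ _ r).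
  by rewrite E0 (eqLp _ _ r0) divff ?inE ?eqxx // gt_eqF // (posp _ _ r0).
suff -> : cce w = a%:R / b%:R.
  by move: ab_in; rewrite !inE !xpair_eqE => /or4P[||| /or4P[||| /or4P[|||]]];
     move=> /andP[/eqP-> /eqP->]; rewrite ?divr1 ?eqxx ?orbT.
have [b0 _] := critical_values_ge ab_in; rewrite /= in b0 E mx.
apply/le_anti/andP; split.
  rewrite E0 ler_pdivrMr ?(posp _ _ r0) // mulrAC ler_pdivlMr ?ltr0n //.
  by rewrite -!natrM ler_nat; apply: mx.
have := circ_rep_cce w0 r; apply: le_trans.
rewrite ler_pdivrMr ?ltr0n // mulrAC ler_pdivlMr ?(posp _ _ r) //.
by rewrite -!natrM E.
Qed.

End CceBounds.

(** * Factors of the Thue-Morse word *)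

(* The 64 letters of the Thue-Morse word from position 32 q on are the image
   under the fifth power of [mu] of its letters q and q + 1, so for [n <= 33]
   every factor of length [n] at a position of parity [par] is listed. *)
Definition tm_factors (n : nat) (par : bool) : seq (seq bool) :=
  undup [seq take n (drop o (iter 5 mu_word ab))
        | ab <- [:: [:: false; false]; [:: false; true];
                    [:: true; false]; [:: true; true]],
          o <- [seq o <- iota 0 32 | odd o == par]].

Definition max_reps (x : seq bool) (m : nat) : seq (nat * nat) :=
  [seq (max_rep x p, p) | p <- iota 1 m].

(** Every circular factor occurs in [w ++ w], but a run there can outgrow [w], so it is cut at
    [size w]. *)
Definition circular_max_reps (w : seq bool) : seq (nat * nat) :=
  [seq (minn (max_rep (w ++ w) p) (size w), p) | p <- iota 1 (size w)].

(** In a factor of odd length the last 12 letters start at a parity opposite to that of the first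
    12. Critical values being at least 7/3, this also yields a repetition of that exponent. *)
Lemma odd_seam_small (par : bool) :
  all (fun s => all (fun q => max_critical (max_reps (s ++ q) 7))
                 (tm_factors 12 par)) (tm_factors 12 (~~ par)).
Proof. case: par; vm_compute; reflexivity. Qed.

(** As 27 is odd, both sides now start at the same parity. Periods 8 to 23 never exceed exponent
    7/3. *)
Lemma odd_seam_large (par : bool) :
  all (fun s => all (fun q =>
      all (fun p => 3 * max_rep (s ++ q) p <= 7 * p) (iota 8 16))
    (tm_factors 27 par)) (tm_factors 27 par).
Proof. case: par; vm_compute; reflexivity. Qed.

Lemma even_seam :
  all (fun s => all (fun q => (last false s == head false q) ==>
      (at_most_square (max_reps (s ++ q) 7) ||
       max_critical (max_reps (s ++ q) 7)))
    (tm_factors 12 true)) (tm_factors 12 true).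
Proof. vm_compute; reflexivity. Qed.

(** From length 27 on, the seam windows of radius 12 and 27 are available. *)
Lemma short_words :
  all (fun n => all (fun w =>
      at_most_square (circular_max_reps w) ||
      max_critical (circular_max_reps w))
    (undup (tm_factors n true ++ tm_factors n false))) (iota 1 26).
Proof. vm_compute; reflexivity. Qed.

Definition tm_slice (i n : nat) : seq bool := mkseq (fun k => tm (i + k)) n.

Lemma size_tm_slice i n : size (tm_slice i n) = n.
Proof. exact: size_mkseq. Qed.

Lemma nth_tm_slice i n j : j < n -> nth false (tm_slice i n) j = tm (i + j).
Proof. by move=> lt; rewrite nth_mkseq. Qed.

Lemma mu_tm_slice i n : mu_word (tm_slice i n) = tm_slice i.*2 n.*2.
Proof.
apply: (@eq_from_nth _ false) => [|j];
  first by rewrite size_mu_word !size_tm_slice.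
rewrite size_mu_word size_tm_slice => ltj; rewrite nth_tm_slice //.
rewrite -[j]odd_double_half addnC nth_mu_word ?size_tm_slice; last lia.
by rewrite nth_tm_slice ?addnA -?doubleD ?tm_mu_image //; lia.
Qed.

Lemma take_drop_tm_slice i m o n : o + n <= m ->
  take n (drop o (tm_slice i m)) = tm_slice (i + o) n.
Proof.
move=> le; apply: (@eq_from_nth _ false) => [|j].
  by rewrite size_takel ?size_drop !size_tm_slice //; lia.
rewrite size_takel ?size_drop ?size_tm_slice; last lia.
move=> lt; rewrite nth_take // nth_drop !nth_tm_slice //; last lia.
by rewrite addnA.
Qed.

Lemma tm_slice_factor i n : n <= 33 -> tm_slice i n \in tm_factors n (odd i).
Proof.
move=> le; rewrite mem_undup; apply/allpairsPdep.
exists (tm_slice (i %/ 32) 2), (i %% 32); split.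
- by rewrite /tm_slice /mkseq /=; case: (tm _); case: (tm _).
- by rewrite mem_filter mem_iota; lia.
rewrite /= !mu_tm_slice take_drop_tm_slice; last lia.
by congr tm_slice; lia.
Qed.

Section GoodFromReps.
Variables (w : seq bool) (reps : seq (nat * nat)).

Lemma good_at_most_square : at_most_square reps ->
  (forall L p, circ_rep w L p -> p.*2 < L ->
    exists2 M, (M, p) \in reps & L <= M) ->
  good w.
Proof.
move=> /allP sq cover; left=> L p r; rewrite leqNgt; apply/negP => lt.
by have [M /sq /=] := cover L p r lt; lia.
Qed.

(** Covering exponents above 7/3 suffices, since the critical value attained is at least 7/3. *)
Lemma good_max_critical : max_critical reps ->
  (forall Lp, Lp \in reps -> circ_rep w Lp.1 Lp.2) ->
  (forall L p, circ_rep w L p -> 7 * p < 3 * L ->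
    exists2 M, (M, p) \in reps & L <= M) ->
  good w.
Proof.
move=> /hasP[ab ab_in /andP[/hasP[[L p] /= Lp_in /eqP E] /allP ub]] sound cover.
have [b0 ge] := critical_values_ge ab_in.
right; exists ab => //; split; first by exists L, p; split=> //;
  apply: sound Lp_in.
move=> L' p' r; case: (ltnP (7 * p') (3 * L')) => [big|small]; last by nia.
have [M /ub /= H le] := cover _ _ r big.
by apply: leq_trans H; rewrite leq_mul2r le orbT.
Qed.

End GoodFromReps.

Lemma nth_circ_double (w : seq bool) j : j < (size w).*2 ->
  nth false (w ++ w) j = circ w j.
Proof.
move=> lt; rewrite nth_cat; case: ltnP => [?|?]; first by rewrite circ_small.
by rewrite circ_wrap.
Qed.

Lemma good_short (w : seq bool) : w != [::] ->
  at_most_square (circular_max_reps w) || max_critical (circular_max_reps w) ->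
  good w.
Proof.
move=> w0.
have cover L p : circ_rep w L p ->
    exists2 M, (M, p) \in circular_max_reps w & L <= M.
  move=> r; have [i lti per] := circ_rep_start w0 r; have [pL [leL _]] := r.
  exists (minn (max_rep (w ++ w) p) (size w)).
    by apply/mapP; exists p => //; rewrite mem_iota; lia.
  rewrite leq_min leL andbT; apply: (@max_rep_ge _ _ i);
    first by rewrite size_cat; lia.
  by move=> j lej ltj; rewrite !nth_circ_double; [apply: per| |]; lia.
case/orP=> [sq|mx]; first by apply: good_at_most_square sq _ => L p r _;
  apply: cover.
apply: (good_max_critical mx) => [Lp /mapP[p]|L p r _]; last exact: cover.
rewrite mem_iota => lep -> /=.
have [|i lei per] := @max_rep_attained (w ++ w) p; first by rewrite size_cat;
  lia.
have : p <= max_rep (w ++ w) p by apply: leq_addl.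
move=> lep'.
split; first lia; split; first lia.
exists i => j lej ltj; have := per j; rewrite size_cat in lei.
by rewrite !nth_circ_double; [apply| |]; lia.
Qed.

(** * The seam of a factor of the Thue-Morse word *)

Section TmFactor.
Variables (i0 n : nat).
Let w := tm_slice i0 n.

Lemma circ_tm_slice j : j < n -> circ w j = tm (i0 + j).
Proof. by move=> lt; rewrite circ_small ?size_tm_slice ?nth_tm_slice. Qed.

Lemma circ_tm_slice_wrap j : n <= j -> j < n.*2 -> circ w j = tm (i0 + (j - n)).
Proof.
by move=> ? ?; rewrite circ_wrap ?size_tm_slice // nth_tm_slice //; lia.
Qed.

(** A repetition of exponent above 2 that avoided the seam would be an overlap in [tm]. *)
Lemma circ_rep_seam L p : circ_rep w L p -> p.*2 < L ->
  exists i, [/\ i < n, n < i + L, i + L <= n.*2, rep (circ w) i L p &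
    rep (fun j => if j < n - i then tm (i0 + i + j)
                  else tm (i0 + (j - (n - i)))) 0 L p].
Proof.
move=> r lt; have [pL [leL _]] := r.
rewrite size_tm_slice in leL.
have [|i lti per] := circ_rep_start (w := w) _ r;
  first by rewrite -size_eq0 size_tm_slice; lia.
rewrite size_tm_slice in lti.
exists i; split=> //; last 1 first.
- have E j : j < L -> (if j < n - i then tm (i0 + i + j)
                       else tm (i0 + (j - (n - i)))) = circ w (i + j).
    move=> ltj; case: ltnP => [?|?]; first by rewrite circ_tm_slice ?addnA //;
      lia.
    by rewrite circ_tm_slice_wrap; [congr tm; lia|lia|lia].
  by move=> j _ ltj; rewrite !E; [rewrite addnA; apply: per; lia|lia|lia].
- rewrite ltnNge; apply/negP => le.
  have : L <= p.*2; last lia.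
  apply: (@tm_overlap_free (i0 + i)); first lia.
  move=> j lej ltj; have := per (j - i0); rewrite !circ_tm_slice; [|lia|lia].
  rewrite (_ : i0 + (j - i0) = j); last lia.
  by rewrite (_ : i0 + (j - i0 + p) = j + p); [apply|]; lia.
- lia.
Qed.

Variable r : nat.
Hypothesis le_rn : r <= n.

Definition seam_window : seq bool := tm_slice (i0 + n - r) r ++ tm_slice i0 r.

Lemma size_seam_window : size seam_window = r.*2.
Proof. by rewrite size_cat !size_tm_slice addnn. Qed.

Lemma nth_seam_window j : j < r.*2 ->
  nth false seam_window j = circ w (n - r + j).
Proof.
move=> lt; rewrite nth_cat size_tm_slice; case: ltnP => [?|?];
  rewrite nth_tm_slice.
- by rewrite circ_tm_slice; [congr tm|]; lia.
- by [].
- by rewrite circ_tm_slice_wrap; [congr tm| |]; lia.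
- by lia.
Qed.

Lemma seam_window_ge i L p : rep (circ w) i L p -> n - r <= i ->
  i + L <= n + r -> L <= max_rep seam_window p.
Proof.
move=> per lei leL; apply: (@max_rep_ge _ _ (i - (n - r)));
  first by rewrite size_seam_window; lia.
by move=> j lej ltj; rewrite !nth_seam_window; [rewrite addnA; apply: per| |];
  lia.
Qed.

(** With [r.*2 <= n] the two halves of the window do not overlap in [w], so it is a factor of a
    conjugate. *)
Lemma seam_window_rep p : r.*2 <= n -> 0 < p <= r.*2 ->
  circ_rep w (max_rep seam_window p) p.
Proof.
move=> le lep; have [|i lei per] := @max_rep_attained seam_window p.
  by rewrite size_seam_window; lia.
rewrite size_seam_window in lei; rewrite /circ_rep size_tm_slice.
split; first by rewrite leq_addl; lia.
split; first lia.
exists (n - r + i) => j lej ltj; have := per (j - (n - r)).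
rewrite !nth_seam_window; [|lia|lia].
rewrite (_ : n - r + (j - (n - r)) = j); last lia.
by rewrite (_ : n - r + (j - (n - r) + p) = j + p); [apply|]; lia.
Qed.

End TmFactor.

(** Radius 12 supplies the maximum over periods up to 7; radius 27 excludes exponents above 7/3 for
    the larger periods. *)
Lemma good_odd_slice i n : odd n -> 27 <= n -> good (tm_slice i n).
Proof.
move=> oddn le27; pose reps r := max_reps (seam_window i n r) 7.
apply: (@good_max_critical _ (reps 12)) => [|Lp /mapP[p]|L p r big].
- have /allP/(_ (tm_slice (i + n - 12) 12)) := odd_seam_small (odd i).
  have -> : ~~ odd i = odd (i + n - 12) by lia.
  by move=> /(_ (tm_slice_factor _ _)) /allP; apply=> //;
    apply: tm_slice_factor.
- by rewrite mem_iota => lep -> /=; apply: seam_window_rep; lia.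
have [|i' [lti lt leL per seam]] := circ_rep_seam r; first lia.
have [/andP[p0 _] _] := r.
have [||||||p24 k27 q27 p7] := odd_seam_bounds seam; try lia.
have [lep|gtp] := leqP p 7.
  exists (max_rep (seam_window i n 12) p).
    by apply/mapP; exists p => //; rewrite mem_iota; lia.
  by have /andP[? ?] := p7 lep; apply: (seam_window_ge _ per); lia.
have le : L <= max_rep (seam_window i n 27) p by apply: (seam_window_ge _ per);
  lia.
have := @tm_slice_factor (i + n - 27) 27 isT; have := @tm_slice_factor i 27 isT.
rewrite (_ : odd (i + n - 27) = odd i) => [q_in s_in|]; last lia.
have /allP/(_ _ s_in)/allP/(_ _ q_in)/allP/(_ p) := odd_seam_large (odd i).
by rewrite mem_iota -/(seam_window i n 27) => /(_ ltac:(lia)); lia.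
Qed.

Lemma good_even_slice i n : ~~ odd n -> odd i -> tm i = tm (i + n).-1 ->
  27 <= n -> good (tm_slice i n).
Proof.
move=> evn oddi eqi le27; pose reps := max_reps (seam_window i n 12) 7.
have cover L p : circ_rep (tm_slice i n) L p -> p.*2 < L ->
    exists2 M, (M, p) \in reps & L <= M.
  move=> r big; have [i' [lti lt leL per seam]] := circ_rep_seam r big.
  have [/andP[p0 _] _] := r.
  have [|||||||p7 k12 q12] := even_seam_bounds seam; try lia.
    by rewrite eqi; congr tm; lia.
  exists (max_rep (seam_window i n 12) p).
    by apply/mapP; exists p => //; rewrite mem_iota; lia.
  by apply: (seam_window_ge _ per); lia.
have : at_most_square reps || max_critical reps.
  have := @tm_slice_factor (i + n - 12) 12 isT; have :=
    @tm_slice_factor i 12 isT.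
  rewrite oddi (_ : odd (i + n - 12) = true) => [q_in s_in|]; last lia.
  have /allP/(_ _ s_in)/allP/(_ _ q_in)/implyP := even_seam; apply.
  by rewrite /tm_slice /= addn0 eqi; apply/eqP; congr tm; lia.
case/orP=> [sq|mx]; first exact: good_at_most_square sq cover.
apply: (good_max_critical mx) => [Lp /mapP[p]|L p r big];
  last by apply: cover r _; lia.
by rewrite mem_iota => lep -> /=; apply: seam_window_rep; lia.
Qed.

Lemma good_tm_slice i n : 0 < n -> good (tm_slice i n).
Proof.
elim/ltn_ind: n i => n IH i n0.
have ne j m : 0 < m -> tm_slice j m != [::] by rewrite -size_eq0 size_tm_slice;
  lia.
have [le27|lt27] := leqP 27 n; last first.
  apply: good_short; first exact: ne.
  have /allP/(_ n) := short_words; rewrite mem_iota => /(_ ltac:(lia)) /allP;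
    apply.
  have : tm_slice i n \in tm_factors n (odd i) by apply: tm_slice_factor; lia.
  by rewrite mem_undup mem_cat => in_n; apply/orP; case: (odd i) in_n;
    [left|right].
have [oddn|evn] := boolP (odd n); first exact: good_odd_slice.
(* At an even start the slice is the [mu] image of a slice of half the length. *)
have even_start j : ~~ odd j -> good (tm_slice j n).
  move=> evj; have -> : tm_slice j n = mu_word (tm_slice j./2 n./2).
    by rewrite mu_tm_slice !even_halfK.
  by apply: good_mu; [apply: ne | apply: IH]; lia.
have [oddi|] := boolP (odd i); last exact: even_start.
have [/good_even_slice|neq] := eqVneq (tm i) (tm (i + n).-1); first exact.
(* The last letter differs from [tm i], hence equals [tm i.-1]; moving it to the front gives the
   slice starting at the even position [i.-1]. *)
apply: (@good_rot n.-1); first by rewrite size_tm_slice; lia.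
have -> : rot n.-1 (tm_slice i n) = tm_slice i.-1 n; last by apply: even_start;
  lia.
have evi : ~~ odd i.-1 by lia.
have := mu_image_block tm_mu_image evi; rewrite prednK; last lia.
move=> ti; apply: (@eq_from_nth _ false) => [|j].
  by rewrite size_rot !size_tm_slice.
rewrite size_rot size_tm_slice => ltj.
rewrite -circ_small ?size_rot ?size_tm_slice // circ_rot ?size_tm_slice;
  last lia.
rewrite nth_tm_slice //; case: j ltj => [|j] ltj.
  rewrite add0n circ_tm_slice; last lia.
  rewrite addn0; rewrite (_ : i + n.-1 = (i + n).-1); last lia.
  by move: neq; rewrite ti; case: (tm i.-1); case: (tm _).
by rewrite circ_tm_slice_wrap; [congr tm| |]; lia.
Qed.

Local Open Scope ring_scope.

Theorem theorem9 (w : seq bool) (w_nonempty : w <> [::])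
    (w_factor : factor_of_infinite thue_morse w) :
  cce w \in [:: 1; 2; 7 / 3; 17 / 7; 5 / 2; 13 / 5; 8 / 3; 3;
                10 / 3; 7 / 2; 11 / 3; 4 : rat].
Proof.
have w0 : w != [::] by apply/eqP.
apply: good_cce => //; have [i ->] := w_factor.
by apply: good_tm_slice; rewrite lt0n size_eq0.
Qed.
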